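(* For $n\geq0$, \[v_{2n}=u_{2n}+u_{2n-1},\] and, with $V(x)=\sum_{n\ge0}v_{2n}x^{2n}$, $U_e(x)=\sum_{n\geq0}u_{2n}x^{2n}$, $U_o(x)=\sum_{n\geq0}u_{2n+1}x^{2n+1}$, \[V(x)=U_e(x)+xU_o(x).\]
   Context: For a multiset $M$ of positive integers, a permutation of $M$ is a word using each element of $M$ with its multiplicity. A word $w_1\cdots w_m$ contains the pattern $132$ if there are $a<b<c$ with $w_a<w_c<w_b$; otherwise it is $132$-avoiding. For $n\ge0$ let $u_{2n}$ be the number of $132$-avoiding permutations of $\{1^2,\dots,n^2\}$, $u_{2n+1}$ the number of $132$-avoiding permutations of $\{1^2,\dots,n^2,n+1\}$, and for $n\ge1$ let $v_{2n}$ be the number of $132$-avoiding permutations of $\{1^2,2^2,\dots,(n-1)^2,n,n+1\}$. Set $u_0=v_0=1$ and $u_m=v_m=0$ for $m<0$. *)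

(* Defs.v *)
From mathcomp Require Import all_boot all_order all_algebra.

Set Implicit Arguments.
Unset Strict Implicit.
Unset Printing Implicit Defensive.

Import GRing.Theory.

Definition contains132 (w : seq nat) : bool :=
  [exists a : 'I_(size w), exists b : 'I_(size w), exists c : 'I_(size w),
    [&& a < b, b < c, nth 0 w a < nth 0 w c & nth 0 w c < nth 0 w b]].

Definition avoids132 (w : seq nat) : bool := ~~ contains132 w.

(* A multiset is given by any listing M of its elements; [permutations M] is
   the duplicate-free list of its distinct rearrangements. *)
Definition num_avoiding132 (M : seq nat) : nat :=
  count avoids132 (permutations M).

(* The multiset {1^2, ..., n^2}. *)
Definition doubled (n : nat) : seq nat := flatten [seq [:: i; i] | i <- iota 1 n].

Definition u (m : int) : nat :=
  match m with
  | Posz k => num_avoiding132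
                (if odd k then rcons (doubled k./2) k./2.+1 else doubled k./2)
  | Negz _ => 0
  end.

(* [v2 n] is v_{2n}: the sequence v is only defined at even indices. *)
Definition v2 (n : int) : nat :=
  match n with
  | Posz 0 => 1
  | Posz (k.+1) => num_avoiding132 (doubled k ++ [:: k.+1; k.+2])
  | Negz _ => 0
  end.

(* Formal power series over int, as coefficient sequences; their equality is
   the coefficientwise one, [=1]. *)
Definition fps : Type := nat -> int.

Definition fps_add (f g : fps) : fps := fun k => (f k + g k)%R.

Definition fps_mul (f g : fps) : fps :=
  fun k => (\sum_(i < k.+1) f i * g (k - i)%N)%R.

Definition fps_X : fps := fun k => if k == 1 then 1%R else 0%R.

(* The series sum_{n >= 0} a(n) x^{e(n)}, for exponents with e(n) >= n: only
   the terms with n <= k can contribute to the coefficient of x^k. *)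
Definition fps_sum (a : nat -> int) (e : nat -> nat) : fps :=
  fun k => (\sum_(n < k.+1 | e n == k) a n)%R.

Definition V : fps := fps_sum (fun n => Posz (v2 n)) (fun n => 2 * n).
Definition Ue : fps := fps_sum (fun n => Posz (u (2 * n)%N)) (fun n => 2 * n).
Definition Uo : fps := fps_sum (fun n => Posz (u (2 * n + 1)%N)) (fun n => 2 * n + 1).

(* Main.v *)
(** Let [t < t.+1] be the two largest letters of a word [w], each occurring once.
    If [w] starts with [t.+1], deleting that letter neither creates nor destroys
    a 132. Otherwise a 132-avoiding [w] has [t] before [t.+1], since the first
    letter would be the 1 of a pattern ending in [t]; replacing [t.+1] by [t] is
    then reversible (raise the second [t]) and preserves 132-avoidance. *)
Require Import Defs.
From mathcomp Require Import all_boot all_order all_algebra.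
From mathcomp Require Import zify.

Set Implicit Arguments.
Unset Strict Implicit.
Unset Printing Implicit Defensive.

Import GRing.Theory.

(** * Occurrences of the pattern 132 as subsequences *)

Lemma mem_drop_nth (T : eqType) (x0 : T) (s : seq T) (i j : nat) :
  j <= i < size s -> nth x0 s i \in drop j s.
Proof.
move=> /andP[ji lt_i]; rewrite -(subnKC ji) -nth_drop mem_nth // size_drop.
by rewrite ltn_sub2r // (leq_ltn_trans ji).
Qed.

(** Letters replace positions here because subsequences can be carried through maps, concatenations
    and the removal of a head. *)
Lemma contains132P (w : seq nat) :
  reflect (exists a b c, [/\ a < c, c < b & subseq [:: a; b; c] w])
          (contains132 w).
Proof.
apply: (iffP existsP) => [[[i lti] /existsP[[j ltj] /existsP[[k ltk]]]]|].
  move=> /= /and4P[ij jk ac cb].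
  exists (nth 0 w i), (nth 0 w j), (nth 0 w k); split=> //.
  (* Cutting [w] at position [j] leaves the 1 in the prefix and puts the 3 at the head of the
     suffix. *)
  rewrite -{4}(cat_take_drop j w) -(cat1s (nth 0 w i)); apply: cat_subseq.
    by rewrite sub1seq -(nth_take 0 ij) mem_nth // size_take ltj.
  by rewrite (drop_nth 0 ltj) /= eqxx sub1seq mem_drop_nth // jk.
move=> [a [b [c [ac cb]]]].
elim: w => [//|x w IHw] /=; case: eqP => [<- {x IHw}|_ /IHw]; last first.
  move=> [i /existsP[j /existsP[k ijk]]].
  exists (lift ord0 i); apply/existsP; exists (lift ord0 j); apply/existsP.
  by exists (lift ord0 k).
move=> bc_w.
have [j [k [jk ltk eb ec]]] :
    exists j k, [/\ j < k, k < size w, nth 0 w j = b & nth 0 w k = c].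
  elim: w bc_w => [//|x w IHw] /=; case: eqP => [<- {x IHw}|_ /IHw].
    rewrite sub1seq => c_w; exists 0, (index c w).+1.
    by split=> //=; rewrite ?ltnS ?index_mem ?nth_index.
  by move=> [j [k [jk ltk eb ec]]]; exists j.+1, k.+1.
exists ord0; apply/existsP.
exists (@Ordinal (size w).+1 j.+1 (ltn_trans jk ltk)); apply/existsP.
by exists (@Ordinal (size w).+1 k.+1 ltk); rewrite /= eb ec ltnS jk ac.
Qed.

(** The head of a word can only be the 1 of a pattern, which would need a larger letter after it. *)
Lemma avoids132_cons_max (x : nat) (w : seq nat) :
  {in w, forall y, y <= x} -> avoids132 (x :: w) = avoids132 w.
Proof.
move=> le_x; congr (~~ _).
apply/contains132P/contains132P => -[a [b [c [ac cb abc]]]];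
  exists a, b, c; split=> //; last exact: subseq_trans abc (subseq_cons _ _).
move: abc => /=; case: eqP => // ax bc.
have /le_x : b \in w by apply: (mem_subseq bc); rewrite inE eqxx.
lia.
Qed.

Lemma subseq_map_ex (T1 T2 : eqType) (f : T1 -> T2) (s : seq T2) (w : seq T1) :
  subseq s (map f w) -> exists2 r, subseq r w & s = map f r.
Proof.
move=> /subseqP[m sz_m ->]; exists (mask m w); rewrite ?map_mask //.
exact: mask_subseq.
Qed.

Lemma split_at_index (T : eqType) (x : T) (w : seq T) :
  x \in w -> exists p q, w = p ++ x :: q /\ x \notin p.
Proof.
elim: w => // y w IHw; rewrite inE; case: eqVneq => [-> _|xy /= /IHw].
  by exists [::], w.
by move=> [p [q [-> xp]]]; exists (y :: p), q; rewrite inE (negPf xy).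
Qed.

(** Since [g] undoes [f] on the filtered list, the image under [f] is a duplicate-free part of the
    filtered [s2]. *)
Lemma leq_count_inj (T1 T2 : eqType) (P : pred T1) (Q : pred T2) s1 s2
    (f : T1 -> T2) (g : T2 -> T1) :
  uniq s1 ->
  (forall x, x \in s1 -> P x -> [/\ f x \in s2, Q (f x) & g (f x) = x]) ->
  count P s1 <= count Q s2.
Proof.
move=> uniq_s1 fP; rewrite -!size_filter -(size_map f).
apply: uniq_leq_size => [|y /mapP[x]].
  rewrite map_inj_in_uniq ?filter_uniq // => x y.
  rewrite !mem_filter => /andP[px xs] /andP[py ys] fxy.
  by have [_ _ <-] := fP _ xs px; have [_ _ <-] := fP _ ys py; rewrite fxy.
by rewrite !mem_filter => /andP[px xs] ->; have [-> ->] := fP _ xs px.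
Qed.

Lemma count_bij (T1 T2 : eqType) (P : pred T1) (Q : pred T2) s1 s2
    (f : T1 -> T2) (g : T2 -> T1) :
  uniq s1 -> uniq s2 ->
  (forall x, x \in s1 -> P x -> [/\ f x \in s2, Q (f x) & g (f x) = x]) ->
  (forall y, y \in s2 -> Q y -> [/\ g y \in s1, P (g y) & f (g y) = y]) ->
  count P s1 = count Q s2.
Proof.
move=> uniq_s1 uniq_s2 fP gP; apply/eqP; rewrite eqn_leq.
by rewrite (leq_count_inj uniq_s1 fP) (leq_count_inj uniq_s2 gP).
Qed.

(** * Merging the two largest letters and separating them again *)

Definition lower (t x : nat) : nat := if x == t.+1 then t else x.

Definition raise (t x : nat) : nat := if x == t then t.+1 else x.

(** The inverse of lowering on words whose [t] precedes [t.+1]: the [.+1] keeps the first [t] itself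
    in the unraised prefix. *)
Definition raise_after_first (t : nat) (w : seq nat) : seq nat :=
  take (index t w).+1 w ++ map (raise t) (drop (index t w).+1 w).

Lemma map_lower_id (t : nat) (w : seq nat) :
  t.+1 \notin w -> map (lower t) w = w.
Proof.
move=> tw; apply: map_id_in => x xw; rewrite /lower.
by case: eqP => // xt; rewrite -xt xw in tw.
Qed.

Lemma map_raise_id (t : nat) (w : seq nat) : t \notin w -> map (raise t) w = w.
Proof.
move=> tw; apply: map_id_in => x xw; rewrite /raise.
by case: eqP => // xt; rewrite -xt xw in tw.
Qed.

Lemma map_raiseK (t : nat) (w : seq nat) :
  t.+1 \notin w -> map (lower t) (map (raise t) w) = w.
Proof.
move=> tw; rewrite -map_comp; apply: map_id_in => x xw /=; rewrite /lower /raise.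
case: (x =P t) => [->|_]; first by rewrite eqxx.
by case: eqP => // xt; rewrite -xt xw in tw.
Qed.

Lemma map_lowerK (t : nat) (w : seq nat) :
  t \notin w -> map (raise t) (map (lower t) w) = w.
Proof.
move=> tw; rewrite -map_comp; apply: map_id_in => x xw /=; rewrite /lower /raise.
case: (x =P t.+1) => [->|_]; first by rewrite eqxx.
by case: eqP => // xt; rewrite -xt xw in tw.
Qed.

Lemma notin_map_raise (t : nat) (w : seq nat) : t \notin map (raise t) w.
Proof. by apply/mapP => -[x _]; rewrite /raise; case: eqP; lia. Qed.

Lemma raise_after_first_cat (t : nat) (p q : seq nat) :
  t \notin p -> raise_after_first t (p ++ t :: q) = p ++ t :: map (raise t) q.
Proof.
move=> tp; rewrite /raise_after_first index_cat (negPf tp) /= eqxx addn0.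
by rewrite take_cat drop_cat ltnNge leqnSn /= subSnn /= take0 drop0 -catA.
Qed.

(** As [lower t] is weakly monotone, strict inequalities between images come from strict
    inequalities between the letters. *)
Lemma avoids132_map_lower (t : nat) (w : seq nat) :
  {in w, forall x, x <= t.+1} -> avoids132 w -> avoids132 (map (lower t) w).
Proof.
move=> le_w; apply: contra => /contains132P[a [b [c [ac cb]]]].
move=> /subseq_map_ex[[|a' [|b' [|c' []]]] // r_w [ea eb ec]].
apply/contains132P; exists a', b', c'.
have le_b : b' <= t.+1.
  by apply/le_w/(mem_subseq r_w); rewrite !inE eqxx orbT.
move: ac cb; rewrite ea eb ec /lower.
by do 3!case: eqP => ?; split=> //; lia.
Qed.

(** Lowering destroys a pattern only by identifying its 3 and its 2, that is, when these are [t.+1]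
    and [t] in this order. *)
Lemma avoids132_lower_inv (t : nat) (w : seq nat) :
  {in w, forall x, x <= t.+1} -> ~~ subseq [:: t.+1; t] w ->
  avoids132 (map (lower t) w) -> avoids132 w.
Proof.
move=> le_w no_w; apply: contra => /contains132P[a [b [c [ac cb abc]]]].
have le_b : b <= t.+1.
  by apply/le_w/(mem_subseq abc); rewrite !inE eqxx orbT.
have bc_w : subseq [:: b; c] w := subseq_trans (subseq_cons _ a) abc.
have bc_t : ~ (b = t.+1 /\ c = t).
  by move=> [eb ec]; move: no_w; rewrite -[X in [:: _; X]]ec -eb bc_w.
apply/contains132P; exists (lower t a), (lower t b), (lower t c).
rewrite -[[:: lower t a; lower t b; lower t c]]/(map (lower t) [:: a; b; c]).
by split; [| |exact: map_subseq]; rewrite /lower; do 2!case: eqP => ?; lia.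
Qed.

(** An [x] can only occur in [q], and no [y] is left there to follow it. *)
Lemma not_subseq_cat (T : eqType) (x y : T) (p q : seq T) :
  x != y -> x \notin p -> y \notin q -> ~~ subseq [:: x; y] (p ++ y :: q).
Proof.
move=> xy xp yq; elim: p xp => [_|z p IHp] /=.
  rewrite (negPf xy); apply: contra yq => /mem_subseq-> //.
  by rewrite !inE eqxx orbT.
by rewrite inE negb_or => /andP[/negPf-> /IHp].
Qed.

(** * Counting avoiding words by their head *)

Lemma count_avoiding_head (s : seq nat) (t : nat) :
  {in s, forall x, x <= t} ->
  count (fun w => avoids132 w && (head 0 w == t)) (permutations (t :: s)) =
    num_avoiding132 s.
Proof.
move=> le_s.
apply: (@count_bij _ _ _ _ _ _ behead (cons t)); rewrite ?permutations_uniq //.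
  move=> [|x w]; rewrite !mem_permutations /=; first by move=> /perm_size.
  move=> perm_w /andP[av /eqP xt]; move: perm_w av; rewrite {}xt perm_cons => perm_w.
  by rewrite avoids132_cons_max // => y; rewrite (perm_mem perm_w); apply: le_s.
move=> w; rewrite !mem_permutations /= perm_cons eqxx andbT => perm_w.
by rewrite avoids132_cons_max // => y; rewrite (perm_mem perm_w); apply: le_s.
Qed.

Lemma count_avoiding_not_head (s : seq nat) (t : nat) :
  {in s, forall x, x < t} ->
  count (fun w => avoids132 w && (head 0 w != t.+1))
        (permutations [:: t.+1, t & s]) =
    num_avoiding132 [:: t, t & s].
Proof.
move=> lt_s.
have ts : t \notin s by apply/negP => /lt_s; rewrite ltnn.
have lower_t : lower t t = t by rewrite /lower ltn_eqF.
have tSs : t.+1 \notin s by apply/negP => /lt_s; lia.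
apply: (@count_bij _ _ _ _ _ _ (map (lower t)) (raise_after_first t));
  rewrite ?permutations_uniq //.
- move=> w; rewrite !mem_permutations => perm_w /andP[av hd].
  have mem_w := perm_mem perm_w.
  have le_w : {in w, forall x, x <= t.+1}.
    by move=> x; rewrite mem_w !inE => /or3P[/eqP->|/eqP->|/lt_s] //; lia.
  (* The round trip is where the condition on the head matters: it needs a splitting of [w] at [t]
     with no [t.+1] in the prefix. *)
  split; last 1 first.
  + have /split_at_index[p [q [ew tp]]] : t \in w by rewrite mem_w !inE eqxx orbT.
    have tq : t \notin q.
      have /permP/(_ (pred1 t)) := perm_w.
      rewrite ew count_cat /= eqxx (count_memPn tp) (count_memPn ts) gtn_eqF //.
      by move=> [/count_memPn].
    (* Otherwise the head [h] differs from [t] and [t.+1], so it is smaller than both, and [h],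
       [t.+1], [t] form a 132. *)
    have tSp : t.+1 \notin p.
      apply/negP => tSp; case/negP: av; apply/contains132P.
      move: hd; rewrite ew; case: p ew tp tSp => [//|h p] ew.
      rewrite !inE negb_or eq_sym => /andP[ht tp].
      move=> /orP[/eqP->|tSp /= hN]; first by rewrite eqxx.
      exists h, t.+1, t; split=> //.
        have : h \in w by rewrite ew inE eqxx.
        by rewrite mem_w !inE (negPf hN) (negPf ht) => /lt_s.
      rewrite /= eqxx -[[:: _; _]]cat1s; apply: cat_subseq; rewrite ?sub1seq //.
      by rewrite inE eqxx.
    rewrite ew map_cat /= (map_lower_id tSp) lower_t.
    by rewrite raise_after_first_cat // map_lowerK.
  + rewrite (permPl (perm_map (lower t) perm_w)) /= (map_lower_id tSs).
    by rewrite lower_t /lower eqxx.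
  + exact: avoids132_map_lower.
move=> w; rewrite !mem_permutations => perm_w av.
have mem_w := perm_mem perm_w.
have /split_at_index[p [q [ew tp]]] : t \in w by rewrite mem_w inE eqxx.
have tSw : t.+1 \notin w by rewrite mem_w !inE !gtn_eqF.
have [tSp tSq] : t.+1 \notin p /\ t.+1 \notin q.
  by move: tSw; rewrite ew mem_cat inE !negb_or => /and3P[].
have lowerK : map (lower t) (raise_after_first t w) = w.
  rewrite ew raise_after_first_cat // map_cat /= map_raiseK // map_lower_id //.
  by rewrite lower_t.
(* Cancelling the first [t] leaves [p ++ q] as a rearrangement of [t :: s]; raising turns the other
   [t] into [t.+1] and fixes [p] and [s]. *)
have perm_r : perm_eq (raise_after_first t w) [:: t.+1, t & s].
  rewrite ew raise_after_first_cat // perm_catC /= perm_sym.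
  rewrite -[[:: _, _ & _]]/([:: t.+1] ++ [:: t] ++ s) perm_catCA /= perm_cons.
  move: perm_w; rewrite ew perm_catC /= perm_cons perm_catC.
  move=> /(perm_map (raise t)); rewrite map_cat /=.
  by rewrite (map_raise_id tp) (map_raise_id ts) {2}/raise eqxx perm_catC perm_sym.
split=> //; apply/andP; split.
  (* The word lowers to [w], and its only [t] comes before every raised letter. *)
  apply: (@avoids132_lower_inv t); last by rewrite lowerK.
    move=> x; rewrite (perm_mem perm_r) !inE => /or3P[/eqP->|/eqP->|/lt_s] //; lia.
  rewrite ew raise_after_first_cat //.
  by rewrite not_subseq_cat ?gtn_eqF ?notin_map_raise.
(* The head is either the kept [t] or a letter of [p], hence not [t.+1]. *)
rewrite ew raise_after_first_cat //; case: (p) tSp => [|x p'] /=.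
  by rewrite ltn_eqF.
by rewrite inE negb_or eq_sym => /andP[].
Qed.

Lemma perm_num_avoiding132 (s1 s2 : seq nat) :
  perm_eq s1 s2 -> num_avoiding132 s1 = num_avoiding132 s2.
Proof. by move=> /perm_permutations/permP; apply. Qed.

Lemma num_avoiding132_two_max (s : seq nat) (t : nat) :
  {in s, forall x, x < t} ->
  num_avoiding132 (s ++ [:: t; t.+1]) =
    num_avoiding132 (s ++ [:: t; t]) + num_avoiding132 (rcons s t).
Proof.
move=> lt_s.
have -> : num_avoiding132 (s ++ [:: t; t.+1]) = num_avoiding132 [:: t.+1, t & s].
  apply: perm_num_avoiding132; rewrite perm_catC.
  by rewrite -[_ ++ s]/([:: t] ++ [:: t.+1] ++ s) perm_catCA.
have -> : num_avoiding132 (s ++ [:: t; t]) = num_avoiding132 [:: t, t & s].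
  by apply: perm_num_avoiding132; rewrite perm_catC.
have -> : num_avoiding132 (rcons s t) = num_avoiding132 (t :: s).
  by apply: perm_num_avoiding132; rewrite perm_rcons.
rewrite -(@count_avoiding_head (t :: s) t.+1); last first.
  by move=> x; rewrite inE => /orP[/eqP->|/lt_s] //; lia.
rewrite -count_avoiding_not_head // addnC /num_avoiding132.
(* The avoiding words are split according to whether their head is [t.+1]. *)
rewrite -[LHS]size_filter -(count_predC (fun w => head 0 w == t.+1)).
by rewrite !count_filter; congr (_ + _); apply: eq_count => w /=; rewrite andbC.
Qed.

(** * The given multisets and the coefficients of the series *)

Lemma doubledS (n : nat) : doubled n.+1 = doubled n ++ [:: n.+1; n.+1].
Proof.
by rewrite /doubled -(addn1 n) iotaD map_cat flatten_cat addnC.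
Qed.

Lemma mem_doubled (n x : nat) : x \in doubled n -> x <= n.
Proof.
move=> /flattenP[_ /mapP[i + ->]]; rewrite mem_iota !inE orbb => /andP[_ lt_i].
by move=> /eqP->; rewrite -ltnS -add1n.
Qed.

(** The bound [n <= e n] puts the index [m] inside the truncated sum, and injectivity makes it the
    only contributing one. *)
Lemma fps_sumE (a : nat -> int) (e : nat -> nat) (m : nat) :
  injective e -> (forall n, n <= e n) -> fps_sum a e (e m) = a m.
Proof.
move=> inj_e le_e; rewrite /fps_sum.
have lt_m : m < (e m).+1 by rewrite ltnS le_e.
rewrite (big_pred1 (Ordinal lt_m)) // => i.
by rewrite (inj_eq inj_e).
Qed.

Lemma fps_sum0 (a : nat -> int) (e : nat -> nat) (k : nat) :
  (forall n, e n != k) -> fps_sum a e k = 0%R.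
Proof. by move=> ek; rewrite /fps_sum big_pred0 // => i; apply/negbTE. Qed.

Lemma fps_mulX0 (f : fps) : fps_mul fps_X f 0 = 0%R.
Proof. by rewrite /fps_mul big_ord1 /fps_X /= mul0r. Qed.

Lemma fps_mulXS (f : fps) (k : nat) : fps_mul fps_X f k.+1 = f k.
Proof.
(* Only index 1 of the convolution survives. *)
rewrite /fps_mul 2!big_ord_recl big1 => [|i _]; last by rewrite /fps_X mul0r.
by rewrite /fps_X /= mul0r mul1r add0r addr0 subn1.
Qed.

Lemma v2_u (n : nat) : v2 n = u (2 * n%:Z)%R + u (2 * n%:Z - 1)%R.
Proof.
case: n => [|n].
  (* For [n = 0] the empty word is the only one, and [u] vanishes at -1. *)
  rewrite mulr0 /= /num_avoiding132 /= /avoids132.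
  by case: contains132P => // -[a [b [c []]]].
(* With natural arguments [u] computes: its two values belong to [doubled n] extended by two copies
   or one copy of [n.+1]. *)
have -> : (2 * n.+1%:Z)%R = n.+1.*2%:Z%R by lia.
have -> : (n.+1.*2%:Z - 1)%R = n.*2.+1%:Z%R by lia.
rewrite /= !doubleK odd_double /= uphalf_double doubledS.
by apply: num_avoiding132_two_max => x /mem_doubled.
Qed.

Theorem theorem3p5 :
  (forall n : nat, v2 n = u (2 * n%:Z)%R + u (2 * n%:Z - 1)%R) /\
  V =1 fps_add Ue (fps_mul fps_X Uo).
Proof.
split=> [|k]; first exact: v2_u.
(* At an odd exponent all three coefficients vanish; for the product, the shift by [fps_X] reads
   [Uo] at an even exponent. *)
rewrite /fps_add; have [k_odd|k_even] := boolP (odd k).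
  case: k k_odd => // k k_even.
  by rewrite fps_mulXS /V /Ue /Uo !fps_sum0 // => n; lia.
have -> : k = 2 * k./2 by lia.
move: {k k_even}(k./2) => k.
rewrite /V /Ue !(@fps_sumE _ (fun n => 2 * n)); try by move=> *; lia.
(* The constant term of the product is 0, in agreement with the value of [u] at -1. *)
rewrite v2_u; case: k => [|k]; first by rewrite fps_mulX0.
have -> : 2 * k.+1 = (2 * k + 1).+1 by lia.
rewrite fps_mulXS /Uo (@fps_sumE _ (fun n => 2 * n + 1)); try by move=> *; lia.
by rewrite PoszD; congr (Posz (u _) + Posz (u _))%R; lia.
Qed.
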